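(* Let $n\in\mathbb{P}$, $n\ge 3$. Then \[\sum_{\sigma\in D_n^{\{0,1\}}}(-1)^{\ell(\sigma)}x^{L(\sigma)}=(1+x^2)\prod_{j=4}^{n}\left(1+(-1)^{j-1}x^{\lfloor j/2\rfloor}\right)^2.\]
   Context: $\mathbb{P}=\{1,2,\dots\}$, $[m,n]=\{m,\dots,n\}$, $[n]=[1,n]$. $B_n$ is the group of bijections $\sigma$ of $[-n,n]$ with $\sigma(-j)=-\sigma(j)$, written in window notation $[\sigma(1),\dots,\sigma(n)]$; $D_n$ is the subgroup of those with an even number of negative entries among $\sigma(1),\dots,\sigma(n)$. For $\sigma\in D_n$: $\ell(\sigma)=\mathrm{inv}(\sigma)+\mathrm{nsp}(\sigma)$, where $\mathrm{inv}(\sigma)=|\{(i,j)\in[n]^2:i<j,\sigma(i)>\sigma(j)\}|$ and $\mathrm{nsp}(\sigma)=|\{(i,j)\in[n]^2:i<j,\sigma(i)+\sigma(j)<0\}|$; $L(\sigma)=\mathrm{oinv}(\sigma)+\mathrm{onsp}(\sigma)$, where $\mathrm{oinv}(\sigma)=|\{(i,j)\in[n]^2:i<j,\sigma(i)>\sigma(j),i\not\equiv j\pmod 2\}|$ and $\mathrm{onsp}(\sigma)=|\{(i,j)\in[n]^2:\sigma(i)+\sigma(j)<0,i\not\equiv j\pmod 2\}|$. For $J\subseteq[0,n-1]$, $D_n^J=\{\sigma\in D_n:\sigma(j)<\sigma(j+1)\ \forall j\in J\}$ with the convention $\sigma(0):=-\sigma(2)$.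
   Formalization: In onsp each pair of positions is counted once (i<j), whereas the stated definition of onsp omits i<j; counting ordered pairs makes the identity false already for n=3, where the sum would be 1+x^3 instead of 1+x^2. *)

(* Defs.v *)
From HB Require Import structures.
From mathcomp Require Import all_boot all_order all_algebra all_fingroup.
Set Implicit Arguments.
Unset Strict Implicit.
Unset Printing Implicit Defensive.
Import Order.TTheory GRing.Theory Num.Theory.
Local Open Scope ring_scope.

(* The integer interval [-n, n] is encoded by the ordinals below 2n+1, the
   ordinal i standing for the integer i - n; negation is then rev_ord. *)
Definition zval (n : nat) (i : 'I_(n.*2.+1)) : int := i%:Z - n%:Z.

Lemma zval_rev_ord (n : nat) (i : 'I_(n.*2.+1)) : zval (rev_ord i) = - zval i.
Proof.
rewrite /zval /= subSS opprB -subzn; last by rewrite -ltnS ltn_ord.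
by move: (i : nat) => k; rewrite -addnn PoszD addrAC addrK.
Qed.

Definition Bn (n : nat) : {set {perm 'I_(n.*2.+1)}} :=
  [set s : {perm _} | [forall j, s (rev_ord j) == rev_ord (s j)]].

(* The integer sigma(j); meaningful for 0 <= j <= n. *)
Definition sigma_at (n : nat) (s : {perm 'I_(n.*2.+1)}) (j : nat) : int :=
  zval (s (inord (n + j))).

(* Below, the position j in [n] = {1, ..., n} is written i.+1 with i : 'I_n. *)
Definition Dn (n : nat) : {set {perm 'I_(n.*2.+1)}} :=
  [set s : {perm _} in Bn n | ~~ odd #|[set i : 'I_n | sigma_at s i.+1 < 0]|].

Definition inv (n : nat) (s : {perm 'I_(n.*2.+1)}) : nat :=
  #|[set p : 'I_n * 'I_n | (p.1 < p.2)%N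
       && (sigma_at s p.1.+1 > sigma_at s p.2.+1)]|.

Definition nsp (n : nat) (s : {perm 'I_(n.*2.+1)}) : nat :=
  #|[set p : 'I_n * 'I_n | (p.1 < p.2)%N
       && (sigma_at s p.1.+1 + sigma_at s p.2.+1 < 0)]|.

Definition ell (n : nat) (s : {perm 'I_(n.*2.+1)}) : nat :=
  (inv s + nsp s)%N.

Definition oinv (n : nat) (s : {perm 'I_(n.*2.+1)}) : nat :=
  #|[set p : 'I_n * 'I_n | [&& (p.1 < p.2)%N,
       sigma_at s p.1.+1 > sigma_at s p.2.+1 &
       p.1.+1 != p.2.+1 %[mod 2]]]|.

(* As in nsp, each pair of positions is counted once (i < j): the condition is
   symmetric in i and j, and counting ordered pairs would double the statistic
   (for n = 3 the generating function would be 1 + x^3 instead of 1 + x^2). *)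
Definition onsp (n : nat) (s : {perm 'I_(n.*2.+1)}) : nat :=
  #|[set p : 'I_n * 'I_n | [&& (p.1 < p.2)%N,
       sigma_at s p.1.+1 + sigma_at s p.2.+1 < 0 &
       p.1.+1 != p.2.+1 %[mod 2]]]|.

Definition oddlen (n : nat) (s : {perm 'I_(n.*2.+1)}) : nat :=
  (oinv s + onsp s)%N.

(* sigma with the type D convention sigma(0) := - sigma(2), which overrides the
   actual value sigma(0) = 0. *)
Definition sigma_atD (n : nat) (s : {perm 'I_(n.*2.+1)}) (j : nat) : int :=
  if j == 0%N then - sigma_at s 2 else sigma_at s j.

(* J lists the elements of a subset of [0, n - 1]. *)
Definition DnJ (n : nat) (J : seq nat) : {set {perm 'I_(n.*2.+1)}} :=
  [set s : {perm _} in Dn n | all (fun j => sigma_atD s j < sigma_atD s j.+1) J].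

(* Main.v *)
Require Import Defs.
From mathcomp Require Import all_boot all_order all_algebra all_fingroup.
From mathcomp Require Import zify ring.
Import Order.TTheory GRing.Theory Num.Theory.
Set Implicit Arguments.
Unset Strict Implicit.
Unset Printing Implicit Defensive.
Local Open Scope ring_scope.

(** Write [sigma] in [B_n] as a permutation [p = |sigma|] with signs [e]. For
    [i < j], the pair [(i, j)] contributes [1] to the type D length if
    [p i > p j], and otherwise [2] or [0] according to the sign of [sigma j].
    Hence [(-1) ^ ell] is the signature of [p], and summing over the signs turns
    the generating function into [sum_p sgn p * prod_j h_j (c_j)], where [c_j]
    counts the [i < j] of parity opposite to [j] with [p i < p j].

    Exchanging two consecutive values located at positions of equal parity
    changes only the signature, so only the permutations along whose values the
    parities of the positions alternate survive. Removing the last position from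
    such a permutation destroys the alternation, and so contributes [0], unless
    the removed value is the smallest or the largest one; this gives a two-term
    recursion on [n].

    Positions and values of permutations are numbered from [0]. *)

(** * Removing the last position of a permutation *)

Lemma lift_perm_max_bij (n : nat) :
  bijective (fun vp : 'I_n.+1 * 'S_n => lift_perm ord_max vp.1 vp.2).
Proof.
apply: inj_card_bij => [[v p] [w q] /= eq_vp|]; last first.
  by rewrite card_prod card_ord !card_Sn.
have eq_vw : v = w.
  by rewrite -(lift_perm_id ord_max v p) eq_vp lift_perm_id.
congr (_, _) => //; apply/permP => i; apply: (@lift_inj _ v).
by rewrite -(lift_perm_lift ord_max) eq_vp lift_perm_lift eq_vw.
Qed.

Lemma big_lift_perm (R : nmodType) (n : nat) (P : pred 'S_n.+1)
    (F : 'S_n.+1 -> R) :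
  \sum_(p | P p) F p = \sum_v \sum_(p : 'S_n | P (lift_perm ord_max v p))
                          F (lift_perm ord_max v p).
Proof.
by rewrite pair_big_dep /= (reindex _ (onW_bij _ (lift_perm_max_bij n))).
Qed.

Definition below_opp (n : nat) (p : 'S_n) (j : 'I_n) : nat :=
  (\sum_(i < n) [&& i < j, odd i != odd j & p i < p j])%N.

Lemma below_opp_lift (n : nat) (v : 'I_n.+1) (p : 'S_n) (j : 'I_n) :
  below_opp (lift_perm ord_max v p) (lift ord_max j) = below_opp p j.
Proof.
rewrite /below_opp (bigD1_ord ord_max) // lift_max.
have /negbTE -> : ~~ (@ord_max n < j)%N by rewrite -leqNgt ltnW /=.
rewrite andFb -[RHS]add0n; congr (_ + _)%N; apply: eq_bigr => i _.
by rewrite !lift_perm_lift !lift_max /= !ltnNge leq_bump2.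
Qed.

Lemma below_opp_max (n : nat) (v : 'I_n.+1) (p : 'S_n) :
  below_opp (lift_perm ord_max v p) ord_max
    = (\sum_(i < n) ((odd i != odd n) && (p i < v)))%N.
Proof.
rewrite /below_opp (bigD1_ord ord_max) // ltnn andFb -[RHS]add0n.
congr (_ + _)%N; apply: eq_bigr => i _.
rewrite lift_perm_lift lift_perm_id !lift_max ltn_ord /=.
by congr (nat_of_bool (_ && _)); rewrite /bump; lia.
Qed.

Lemma sum_odd_neq (n : nat) (b : bool) :
  (\sum_(i < n) (odd i != b) = if b then uphalf n else n./2)%N.
Proof.
elim: n => [|n IHn]; first by rewrite big_ord0; case: b.
by rewrite big_ord_recr /= {}IHn; case: b; rewrite uphalf_half; lia.
Qed.

Lemma sum_opp_parity (n : nat) : (\sum_(i < n) (odd i != odd n) = uphalf n)%N.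
Proof. by rewrite sum_odd_neq uphalf_half; case: (odd n). Qed.

(** Here [q a] is the parity of the position holding the value [a]. With [q] indexed by values,
    deleting the value [v] turns [q] into [q \o bump v]. *)
Definition has_parity (n : nat) (q : nat -> bool) (p : 'S_n) : bool :=
  [forall i : 'I_n, odd i == q (p i)].

Lemma has_parity_lift (n : nat) (q : nat -> bool) (v : 'I_n.+1) (p : 'S_n) :
  has_parity q (lift_perm ord_max v p)
    = (odd n == q v) && has_parity (q \o bump v) p.
Proof.
apply/forallP/andP => [qP|[qv /forallP qP] i].
  split; first by move: (qP ord_max); rewrite lift_perm_id.
  by apply/forallP => i; move: (qP (lift ord_max i)); rewrite lift_perm_lift lift_max.
case: (unliftP ord_max i) => [j|] ->; last by rewrite lift_perm_id.
by rewrite lift_perm_lift lift_max; apply: qP.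
Qed.

(** No third value lies between [a] and [a.+1], so exchanging them affects only their comparison
    with each other. *)
Lemma ltn_tperm (n : nat) (a b x y : 'I_n) : b = a.+1 :> nat ->
  (x, y) != (a, b) -> (x, y) != (b, a) ->
  (tperm a b x < tperm a b y)%N = (x < y)%N.
Proof.
move=> ab; rewrite !xpair_eqE -!val_eqE /=.
have val_neq (z w : 'I_n) : z <> w -> (z : nat) <> w by move=> zw /val_inj.
case: tpermP => [->|->|/val_neq xa /val_neq xb];
  case: tpermP => [->|->|/val_neq ya /val_neq yb]; lia.
Qed.

(** * Signed sums over permutations with a given parity pattern *)

Section SignedSums.
Variables (R : comNzRingType) (h : nat -> nat -> R).

Definition perm_weight (n : nat) (p : 'S_n) : R :=
  (-1) ^+ p * \prod_(j < n) h j (below_opp p j).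

Definition parity_sum (n : nat) (q : nat -> bool) : R :=
  \sum_(p : 'S_n | has_parity q p) perm_weight p.

Lemma eq_parity_sum (n : nat) (q q' : nat -> bool) :
  (forall a, (a < n)%N -> q a = q' a) -> parity_sum n q = parity_sum n q'.
Proof.
by move=> qq'; apply: eq_bigl => p; apply: eq_forallb => i; rewrite qq'.
Qed.

(* Exchanging the values [a] and [a.+1] flips the sign and nothing else. *)
Lemma parity_sum_eq0 (n : nat) (q : nat -> bool) (a : nat) :
  (a.+1 < n)%N -> q a = q a.+1 -> parity_sum n q = 0.
Proof.
move=> lt_a1n qa; have lt_an := ltnW lt_a1n.
pose x := Ordinal lt_an; pose y := Ordinal lt_a1n.
have xy : x != y by rewrite -val_eqE /= neq_ltn ltnSn.
have qt (z : 'I_n) : q (tperm x y z) = q z.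
  by case: tpermP => [->|->|//]; rewrite /= qa.
have parM (p : 'S_n) : has_parity q (p * tperm x y)%g = has_parity q p.
  by apply: eq_forallb => i; rewrite permM qt.
rewrite /parity_sum (bigID (@odd_perm _)) /=.
rewrite (reindex_inj (mulIg (tperm x y))) /=.
under eq_bigl do rewrite parM odd_permM odd_tperm xy addbT.
rewrite -big_split /= big1 // => p /andP[/forallP pq _].
rewrite /perm_weight odd_permM odd_tperm xy addbT signrN mulNr.
suff -> : \prod_(j < n) h j (below_opp (p * tperm x y)%g j)
            = \prod_(j < n) h j (below_opp p j).
  exact: addNr.
apply: eq_bigr => j _; congr h; apply: eq_bigr => i _; congr nat_of_bool.
(* Positions of opposite parity cannot hold [a] and [a.+1], so [ltn_tperm] applies to every pair
   that is counted. *)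
congr (_ && _); case: (eqVneq (odd i) (odd j)) => //= odd_ij; rewrite !permM.
by rewrite ltn_tperm //; apply: contra odd_ij => /eqP[pi pj];
   rewrite (eqP (pq i)) (eqP (pq j)) pi pj /= qa.
Qed.

(** Let [v] be the value at the last position. As [q] fixes the parity of the position of each
    value, the count at [n] depends on [v] alone and factors out. *)
Lemma parity_sumS (n : nat) (q : nat -> bool) :
  parity_sum n.+1 q = \sum_(v < n.+1 | odd n == q v) (-1) ^+ (n + v)
    * h n (\sum_(b < n) ((q (bump v b) != odd n) && (b < v)))%N
    * parity_sum n (q \o bump v).
Proof.
rewrite /parity_sum big_lift_perm [RHS]big_mkcond /=; apply: eq_bigr => v _.
rewrite (eq_bigl _ _ (has_parity_lift q v)) /=.
case: eqP => _ /=; last by rewrite big_pred0.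
rewrite big_distrr /=; apply: eq_bigr => p /forallP qp.
rewrite /perm_weight (bigD1_ord ord_max) // below_opp_max odd_lift_perm.
rewrite (eq_bigr (fun j : 'I_n => h j (below_opp p j))) => [|j _]; last first.
  by rewrite lift_max below_opp_lift.
rewrite /= [RHS]mulrACA; congr (_ * (_ * _)).
  by rewrite -oddD signr_addb signr_odd.
congr h; rewrite [RHS](reindex_inj (@perm_inj _ p)) /=; apply: eq_bigr => i _.
by rewrite (eqP (qp i)).
Qed.

Definition alternating (b : bool) (a : nat) : bool := odd a (+) b.

Lemma alternating_or_repeat (n : nat) (q : nat -> bool) :
  (forall a, (a < n.+1)%N -> q a = alternating (q 0%N) a)
  \/ exists2 a, (a.+1 < n.+1)%N & q a = q a.+1.
Proof.
elim: n => [|n [alt|[a lt_an qa]]].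
- by left => - [].
- case: (eqVneq (q n) (q n.+1)) => [qn|qn]; first by right; exists n.
  left => a; rewrite ltnS leq_eqVlt => /orP[/eqP ->|/alt //].
  move: qn; rewrite (alt n) // /alternating /=.
  by case: (q n.+1); case: (q 0%N); case: (odd n).
- by right; exists a => //; apply: ltnW.
Qed.

(** Permutations are sorted by the tuple of position parities along their values; a tuple with two
    equal neighbours contributes 0. *)
Lemma perm_sum_alternating (n : nat) :
  \sum_(p : 'S_n.+1) perm_weight p
    = parity_sum n.+1 (alternating false) + parity_sum n.+1 (alternating true).
Proof.
pose pat (p : 'S_n.+1) := [tuple odd (p^-1%g a) | a < n.+1].
pose altt b := [tuple alternating b a | a < n.+1].
have nth_altt b a : (a < n.+1)%N -> nth false (altt b) a = alternating b a.
  by move=> lt_an; rewrite -[a]/(val (Ordinal lt_an)) nth_mktuple.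
have altt_neq : altt true != altt false.
  by apply/eqP => /(congr1 (fun t : n.+1.-tuple bool => nth false t 0)); rewrite !nth_altt.
rewrite (partition_big pat predT) //=.
have patE (t : n.+1.-tuple bool) :
    \sum_(p | pat p == t) perm_weight p = parity_sum n.+1 (nth false t).
  apply: eq_bigl => p; apply/eqP/forallP => [<- i|pt].
    by rewrite nth_mktuple permK.
  apply: eq_from_tnth => a; rewrite tnth_mktuple (tnth_nth false).
  by rewrite (eqP (pt _)) permKV.
under eq_bigr do rewrite patE.
rewrite (bigD1 (altt false)) // (bigD1 (altt true)) //= big1 ?addr0.
  by congr (_ + _); apply: eq_parity_sum; apply: nth_altt.
move=> t /andP[t0 t1].
have [alt|[a]] := alternating_or_repeat n (nth false t); last exact: parity_sum_eq0.
suff : t = altt (nth false t 0).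
  by case: (nth _ _ _) => /eqP; rewrite ?(negPf t0) ?(negPf t1).
by apply: eq_from_tnth => a; rewrite !(tnth_nth false) alt // nth_altt.
Qed.

(* Only the smallest and largest values can be removed from an alternating
   pattern without creating two neighbours of equal parity. *)
Lemma parity_sum_alternatingS (n : nat) (b : bool) :
  parity_sum n.+2 (alternating b)
    = (if odd n.+1 == b then (-1) ^+ n.+1 * h n.+1 0
         * parity_sum n.+1 (alternating (~~ b)) else 0)
      + (if b then 0 else h n.+1 (uphalf n.+1) * parity_sum n.+1 (alternating b)).
Proof.
rewrite parity_sumS big_mkcond big_ord_recl big_ord_recr /=.
congr (_ + _).
  rewrite addn0 big1 => [|c _]; last by rewrite andbF.
  rewrite [alternating b 0]/alternating /=; case: eqP => // _; congr (_ * _).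
  by apply: eq_parity_sum => a _; rewrite /alternating /=; case: (odd a); case: b.
rewrite -[RHS]add0r; congr (_ + _).
  (* The removed value is [v.+1]: its neighbours [v] and [v.+2], at positions of equal parity,
     become adjacent. *)
  apply: big1 => v _; case: eqP => // _.
  rewrite (@parity_sum_eq0 _ _ v) ?mulr0 // ?ltnS ?ltn_ord //.
  by rewrite /alternating /bump /=; case: (leqP v.+1 v); case: (leqP v.+1 v.+1); lia.
rewrite [bump 0 n]/bump leq0n /= add1n addnn -signr_odd odd_double expr0 mul1r.
rewrite {1}/alternating /=; case: b => /=; first by case: (odd n).
rewrite addbF eqxx; congr (h _ _ * _); last first.
  by apply: eq_parity_sum => a ltan; rewrite /alternating /bump /= leqNgt ltan.
rewrite -[n./2.+1]/(uphalf n.+1) -sum_opp_parity; apply: eq_bigr => c _.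
by rewrite ltn_ord andbT /alternating /bump leqNgt ltn_ord addbF.
Qed.

Lemma parity_sum1 (b : bool) :
  parity_sum 1 (alternating b) = if b then 0 else h 0 0.
Proof.
rewrite parity_sumS big_mkcond big_ord1 big_ord0 /= expr0 mul1r.
case: b => //=; rewrite -[RHS]mulr1; congr (_ * _).
rewrite /parity_sum (big_pred1 1%g) => [|p]; last first.
  rewrite /= (_ : p == 1%g); last by apply/eqP/permP => -[].
  by apply/forallP => -[].
by rewrite /perm_weight big_ord0 odd_perm1 expr0 mulr1.
Qed.

End SignedSums.

(** * Solving the recursion for the type D weights *)

(* Position [j = 1] is the paper's second one: its factor also encodes the
   constraint [|sigma 1| < sigma 2] (entries numbered from [1]) that
   defines the quotient. *)
Definition sign_weight (j : nat) (e : bool) (c : nat) : {poly int} :=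
  if (j == 1%N) && (e || (c != 1%N)) then 0
  else 'X^(uphalf j - c + (e * c).*2)%N.

Definition rank_weight (j c : nat) : {poly int} :=
  \sum_(e : bool) sign_weight j e c.

Lemma rank_weight0 (j : nat) : (j != 1)%N ->
  rank_weight j 0 = 'X^(uphalf j) *+ 2.
Proof.
move=> j1; rewrite /rank_weight big_bool /sign_weight (negPf j1) /=.
by rewrite muln0 !subn0 addn0 mulr2n.
Qed.

Lemma rank_weight_max (j : nat) : (j != 1)%N ->
  rank_weight j (uphalf j) = 1 + 'X^(uphalf j) ^+ 2.
Proof.
move=> j1; rewrite /rank_weight big_bool /sign_weight (negPf j1) /=.
by rewrite mul1n mul0n subnn !add0n expr0 -muln2 exprM addrC.
Qed.

Definition quotient_poly (n : nat) : {poly int} :=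
  (1 + 'X^2) * \prod_(4 <= j < n.+1) (1 + (-1) ^+ (j - 1) *: 'X^(j %/ 2)) ^+ 2.

Lemma quotient_polyS (n : nat) : (3 <= n)%N ->
  quotient_poly n.+1 = quotient_poly n * (1 + (-1) ^+ n * 'X^(uphalf n)) ^+ 2.
Proof.
move=> n3; rewrite /quotient_poly big_nat_recr //= mulrA subn1 /= divn2 -uphalfE.
by rewrite -signr_odd -[X in _ = _ * (1 + X * _) ^+ 2]signr_odd; case: odd;
  rewrite ?expr0 ?expr1 ?scaleN1r ?scale1r ?mulN1r ?mul1r.
Qed.

(** Among an odd number of positions the even ones are in excess, so no alternating pattern starts
    with an odd one. Two recursion steps multiply the other sum by (1 + x^(2r))^2 - (2 x^r)^2 = (1 -
    x^r)^2 (1 + x^r)^2, where r is the common [uphalf] of the two removed positions. *)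
Lemma alternating_sum_odd (k : nat) : ~~ odd k ->
  (parity_sum rank_weight k.+3 (alternating false) = quotient_poly k.+3 *+ 2)
  /\ parity_sum rank_weight k.+3 (alternating true) = 0.
Proof.
move=> evk; rewrite -[k]odd_double_half (negPf evk) add0n.
elim: {k evk} k./2 => [|m].
  (* As [rank_weight 1 0] is 0 and [rank_weight 1 1] is 1, only removals of the largest value
     survive, giving 2 (1 + x^2). *)
  rewrite !parity_sum_alternatingS !parity_sum1 /= !addr0; split=> //.
  rewrite (@rank_weight_max 2) //.
  rewrite [rank_weight 0 0]rank_weight0 // /quotient_poly big_geq // mulr1.
  rewrite [rank_weight 1 0]/rank_weight [rank_weight 1 1]/rank_weight.
  rewrite !big_bool /sign_weight /= mul0n expr0 !add0r.
  ring.
rewrite doubleS; have := odd_double m; move: m.*2 => k evk [IHA IHB].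
split; last by rewrite parity_sum_alternatingS /= evk addr0.
rewrite parity_sum_alternatingS [in odd _]/= !(@parity_sum_alternatingS _ _ k.+2).
rewrite IHA IHB [in odd _]/= evk [in odd _]/=.
rewrite !rank_weight0 // !rank_weight_max //.
rewrite (@quotient_polyS k.+4) // (@quotient_polyS k.+3) //.
have -> : uphalf k.+4 = uphalf k.+3 by rewrite /= uphalf_half evk.
rewrite -![(-1) ^+ k.+3]signr_odd -![(-1) ^+ k.+4]signr_odd /= evk /=.
ring.
Qed.

(** For even n, one more recursion step brings in both patterns, with total factor 1 + x^(2r) - 2
    x^r = (1 - x^r)^2, r = n/2. *)
Lemma rank_weight_perm_sum (n : nat) : (3 <= n)%N ->
  \sum_(p : 'S_n) perm_weight rank_weight p = quotient_poly n *+ 2.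
Proof.
case: n => [|[|[|k]]] // _; rewrite perm_sum_alternating.
have [oddk|evk] := boolP (odd k); last first.
  by have [-> ->] := alternating_sum_odd evk; rewrite addr0.
case: k oddk => // k /= evk; have [IHA _] := alternating_sum_odd evk.
rewrite !(@parity_sum_alternatingS _ _ k.+2) IHA [in odd _]/= evk.
rewrite [_ == _]/= [true == _]/= rank_weight0 // rank_weight_max //.
rewrite (@quotient_polyS k.+3) //.
rewrite -![(-1) ^+ k.+3]signr_odd /= (negPf evk) /=.
ring.
Qed.

(** * Inversions and the signature *)

Lemma below_opp_uphalf (n : nat) (p : 'S_n) (j : 'I_n) :
  (below_opp p j + \sum_(i < n) [&& i < j, odd i != odd j & p j < p i]
    = uphalf j)%N.
Proof.
rewrite -sum_opp_parity.
rewrite (big_ord_widen n (fun i => nat_of_bool (odd i != odd j))) 1?ltnW //.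
rewrite [RHS]big_mkcond /=.
rewrite -big_split /=; apply: eq_bigr => i _; case: ltnP => // lt_ij.
have : p i != p j by rewrite (inj_eq perm_inj) -val_eqE neq_ltn lt_ij.
by rewrite -val_eqE neq_ltn; case: ltngtP; case: (odd i != odd j).
Qed.

Lemma sum_leq_ord (n v : nat) : (\sum_(b < n) (v <= b) = n - v)%N.
Proof.
elim: n => [|n IHn]; first by rewrite big_ord0.
by rewrite big_ord_recr /= IHn; lia.
Qed.

(** Induction on the last position: if it holds [v], then [n - v] earlier values are larger, in
    agreement with the sign (-1)^(n+v) of [lift_perm]. *)
Lemma odd_perm_inversions (n : nat) (p : 'S_n) :
  odd_perm p = odd (\sum_(j < n) \sum_(i < n) ((i < j) && (p j < p i)))%N.
Proof.
elim: n p => [|n IHn] p.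
  by rewrite big_ord0 (_ : p = 1%g) ?odd_perm1 //; apply/permP => -[].
have [f _ fK] := lift_perm_max_bij n; rewrite -(fK p); case: (f p) => v q /=.
set r := lift_perm _ _ _.
have maxE : (\sum_(i < n.+1) ((i < @ord_max n) && (r ord_max < r i)) = n - v)%N.
  rewrite -sum_leq_ord (reindex_inj (@perm_inj _ q)) (bigD1_ord ord_max) // ltnn.
  rewrite andFb -[RHS]add0n; congr (_ + _)%N; apply: eq_bigr => i _.
  rewrite lift_perm_lift lift_perm_id lift_max ltn_ord /= /bump.
  by congr nat_of_bool; lia.
have liftE j : (\sum_(i < n.+1) ((i < lift ord_max j) && (r (lift ord_max j) < r i))
    = \sum_(i < n) ((i < j) && (q j < q i)))%N.
  rewrite (bigD1_ord ord_max) //.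
  have /negbTE -> : ~~ (@ord_max n < lift ord_max j)%N.
    by rewrite -leqNgt lift_max ltnW /=.
  rewrite andFb -[RHS]add0n; congr (_ + _)%N; apply: eq_bigr => i _.
  by rewrite !lift_perm_lift !lift_max /= !ltnNge leq_bump2.
rewrite odd_lift_perm IHn (bigD1_ord ord_max) // maxE (eq_bigr _ (fun j _ => liftE j)).
by rewrite /= oddD oddB // -ltnS.
Qed.

(** * Elements of [Bn] as permutations with signs *)

Section SignedPermutations.
Variable n : nat.

Definition of_signed (x : option ('I_n * bool)) : 'I_(n.*2.+1) :=
  if x is Some (i, e) then inord (if e then n - i.+1 else n + i.+1)%N else inord n.

Definition to_signed (k : 'I_(n.*2.+1)) : option ('I_n * bool) :=
  odflt None [pick x | of_signed x == k].

Lemma zval_of_signed (i : 'I_n) (e : bool) :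
  zval (of_signed (Some (i, e))) = if e then - (i.+1)%:Z else (i.+1)%:Z.
Proof.
have := ltn_ord i; rewrite /zval /= => lt_in.
by rewrite inordK; case: e => //; lia.
Qed.

Lemma zval_of_signed0 : zval (of_signed None) = 0.
Proof. by rewrite /zval /= inordK ?subrr //; lia. Qed.

Lemma zval_inj : injective (@zval n).
Proof. by move=> i j; rewrite /zval => ij; apply: val_inj => /=; lia. Qed.

Lemma of_signed_inj : injective of_signed.
Proof.
move=> [[i e]|] [[j f]|] // /(congr1 (@zval n));
  rewrite ?zval_of_signed ?zval_of_signed0.
- move=> ij; have [ij' ->] : (i = j :> nat) /\ e = f by case: e f ij => [] []; lia.
  by rewrite (val_inj ij').
- by case: e; lia.
- by case: f; lia.
Qed.

Lemma of_signedK : cancel of_signed to_signed.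
Proof.
move=> x; rewrite /to_signed; case: pickP => [y /eqP/of_signed_inj //|/(_ x)].
by rewrite eqxx.
Qed.

Lemma to_signedK : cancel to_signed of_signed.
Proof.
have [|g gK Kg] := @inj_card_bij _ _ of_signed of_signed_inj.
  by rewrite card_option card_prod card_bool !card_ord muln2.
by move=> k; rewrite -(Kg k) of_signedK.
Qed.

Definition signed_opp (x : option ('I_n * bool)) :=
  omap (fun ie : 'I_n * bool => (ie.1, ~~ ie.2)) x.

Lemma rev_ord_of_signed (x : option ('I_n * bool)) :
  rev_ord (of_signed x) = of_signed (signed_opp x).
Proof.
apply: zval_inj; rewrite zval_rev_ord; case: x => [[i e]|].
  by rewrite !zval_of_signed; case: e; rewrite /= ?opprK.
by rewrite zval_of_signed0 oppr0.
Qed.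

Definition signed_act (p : 'S_n) (e : {ffun 'I_n -> bool})
    (x : option ('I_n * bool)) :=
  omap (fun ie : 'I_n * bool => (p ie.1, ie.2 (+) e ie.1)) x.

Lemma signed_act_inj (p : 'S_n) (e : {ffun 'I_n -> bool}) :
  injective (signed_act p e).
Proof.
by move=> [[i a]|] [[j b]|] //= [/perm_inj -> /addIb ->].
Qed.

Lemma signed_perm_inj_subproof (p : 'S_n) (e : {ffun 'I_n -> bool}) :
  injective (of_signed \o signed_act p e \o to_signed).
Proof.
apply: inj_comp (can_inj to_signedK).
exact: inj_comp of_signed_inj (@signed_act_inj p e).
Qed.

Definition signed_perm (pe : 'S_n * {ffun 'I_n -> bool}) : {perm 'I_(n.*2.+1)} :=
  perm (@signed_perm_inj_subproof pe.1 pe.2).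

Lemma signed_permE pe x :
  signed_perm pe (of_signed x) = of_signed (signed_act pe.1 pe.2 x).
Proof. by rewrite permE /= of_signedK. Qed.

Lemma signed_perm_inj : injective signed_perm.
Proof.
move=> [p e] [p' e'] eq_pe.
have eq_i i : (p i, e i) = (p' i, e' i).
  have := signed_permE (p, e) (Some (i, false)).
  by rewrite eq_pe signed_permE => /of_signed_inj[-> ->].
by congr (_, _); [apply/permP|apply/ffunP] => i; case: (eq_i i).
Qed.

Lemma signed_perm_Bn pe : signed_perm pe \in Bn n.
Proof.
rewrite inE; apply/forallP => k; rewrite -(to_signedK k) rev_ord_of_signed.
rewrite !signed_permE rev_ord_of_signed; apply/eqP; congr of_signed.
by case: (to_signed k) => [[i a]|] //=; rewrite addNb.
Qed.

Lemma signed_perm_onto (s : {perm 'I_(n.*2.+1)}) : s \in Bn n ->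
  exists pe, s = signed_perm pe.
Proof.
rewrite inE => /forallP sN; pose g x := to_signed (s (of_signed x)).
have gE x : s (of_signed x) = of_signed (g x) by rewrite to_signedK.
have g_inj : injective g.
  by move=> x y /(can_inj to_signedK)/perm_inj/of_signed_inj.
have gN x : g (signed_opp x) = signed_opp (g x).
  apply: of_signed_inj; rewrite -rev_ord_of_signed -!gE -rev_ord_of_signed.
  exact/eqP.
(* [None] is the only fixed point of [signed_opp]. *)
have g0 : g None = None by move: (gN None); case: (g None) => [[i []]|].
pose f i := odflt (i, false) (g (Some (i, false))).
have fE i : g (Some (i, false)) = Some (f i).
  rewrite /f; case E: (g _) => [|] //=.
  by move: E; rewrite -g0 => /g_inj.
have f_inj : injective (fst \o f).
  move=> i j /= fij; case: (eqVneq (f i).2 (f j).2) => fij2.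
    suff : Some (i, false) = Some (j, false) by case.
    by apply: g_inj; rewrite !fE (surjective_pairing (f i)) fij fij2 -surjective_pairing.
  (* Images with equal absolute values and opposite signs would identify a positive integer with a
     negative one. *)
  suff : Some (i, false) = Some (j, true) by [].
  apply: g_inj; rewrite -[Some (j, true)]/(signed_opp (Some (j, false))) gN !fE /=.
  rewrite (surjective_pairing (f i)) fij; congr (Some (_, _)).
  by move: fij2; case: (_.2); case: (_.2).
exists (perm f_inj, [ffun i => (f i).2]); apply/permP => k.
rewrite -(to_signedK k) signed_permE gE; congr of_signed.
case: (to_signed k) => [[i a]|] //=; rewrite permE ffunE /=.
case: a; last by rewrite fE -surjective_pairing.
by rewrite -[Some (i, true)]/(signed_opp (Some (i, false))) gN fE.
Qed.

Lemma big_signed_perm (R : nmodType) (A : {set {perm 'I_(n.*2.+1)}})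
    (F : {perm 'I_(n.*2.+1)} -> R) : A \subset Bn n ->
  \sum_(s in A) F s
    = \sum_p \sum_(e | signed_perm (p, e) \in A) F (signed_perm (p, e)).
Proof.
move=> /subsetP sAB; rewrite pair_big_dep /=.
have -> : A = signed_perm @: [set pe | signed_perm pe \in A].
  apply/setP => s; apply/idP/imsetP => [sA|[pe]]; last by rewrite inE => ? ->.
  have [pe def_s] := signed_perm_onto (sAB s sA).
  by exists pe => //; rewrite inE -def_s.
rewrite big_imset /=; last by move=> x y _ _; apply: signed_perm_inj.
apply: eq_big => [[p e]|[p e] _] //=.
by rewrite (mem_imset _ _ signed_perm_inj) !inE.
Qed.

Lemma sigma_at_signed_perm pe (i : 'I_n) :
  sigma_at (signed_perm pe) i.+1
    = if pe.2 i then - (pe.1 i).+1%:Z else (pe.1 i).+1%:Z.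
Proof.
by rewrite /sigma_at -[inord _]/(of_signed (Some (i, false))) signed_permE
  zval_of_signed.
Qed.

End SignedPermutations.

(** * Lengths of a signed permutation *)

Lemma card_pairs (n : nat) (P : 'I_n -> 'I_n -> bool) :
  #|[set ij : 'I_n * 'I_n | P ij.1 ij.2]| = (\sum_(j < n) \sum_(i < n) P i j)%N.
Proof.
rewrite cardsE -sum1_card exchange_big pair_bigA big_mkcond /=.
by apply: eq_bigr => -[i j] _; rewrite unfold_in /=; case: (P i j).
Qed.

Section SignedStatistics.
Variables (n : nat) (pe : 'S_n * {ffun 'I_n -> bool}).
Let s := signed_perm pe.
Let p := pe.1.
Let e := pe.2.

(* For [i < j], the pair is counted once by [inv] and [nsp] together if
   [|s i| > |s j|], and otherwise twice or not at all, by the sign of [s j]. *)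
Lemma signed_pair_count (i j : 'I_n) : i != j ->
  ((sigma_at s j.+1 < sigma_at s i.+1)%R
     + (sigma_at s i.+1 + sigma_at s j.+1 < 0)%R
    = (p j < p i) + (e j * (p i < p j)).*2)%N.
Proof.
rewrite !sigma_at_signed_perm -/p -/e -(inj_eq (@perm_inj _ p)) -val_eqE /=.
by move: (p i : nat) (p j : nat) => a b; case: (e i); case: (e j) => /= ab; lia.
Qed.

Lemma odd_ell : odd (ell s) = odd_perm p.
Proof.
rewrite odd_perm_inversions /ell.
rewrite [Defs.inv s](card_pairs (fun i j => (i < j)%N && (sigma_at s j.+1 < sigma_at s i.+1))).
rewrite [nsp s](card_pairs (fun i j => (i < j)%N && (sigma_at s i.+1 + sigma_at s j.+1 < 0))).
rewrite -big_split /=.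
rewrite (eq_bigr (fun j : 'I_n => (\sum_(i < n) ((i < j) && (p j < p i))
    + (\sum_(i < n) (i < j) * (e j * (p i < p j))).*2)%N)).
  rewrite big_split oddD [X in _ (+) odd X](_ : _ = (\sum_(j < n)
    \sum_(i < n) (i < j) * (e j * (p i < p j))).*2)%N ?odd_double ?addbF //.
  by rewrite -muln2 big_distrl; apply: eq_bigr => j _; rewrite /= muln2.
move=> j _; rewrite -muln2 big_distrl -!big_split; apply: eq_bigr => i _.
case: ltnP => //= lt_ij; rewrite signed_pair_count ?mul1n ?muln2 //.
by rewrite -val_eqE neq_ltn lt_ij.
Qed.

(** Of the [uphalf j] earlier positions of opposite parity, those with a larger value count once and
    the others twice or never, by the sign at [j]. *)
Lemma oddlenE : oddlen s
  = (\sum_(j < n) (uphalf j - below_opp p j + (e j * below_opp p j).*2))%N.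
Proof.
rewrite /oddlen.
rewrite [oinv s](card_pairs (fun i j => [&& (i < j)%N, sigma_at s j.+1 < sigma_at s i.+1
  & i.+1 != j.+1 %[mod 2]])).
rewrite [onsp s](card_pairs (fun i j => [&& (i < j)%N, sigma_at s i.+1 + sigma_at s j.+1 < 0
  & i.+1 != j.+1 %[mod 2]])).
rewrite -big_split /=; apply: eq_bigr => j _.
rewrite -(below_opp_uphalf p) addKn -muln2 big_distrr big_distrl -!big_split /=.
apply: eq_bigr => i _; rewrite !modn2 /= (inj_eq (can_inj oddb)) (inj_eq negb_inj).
case: ltnP => /= lt_ij; last by rewrite muln0.
have ij : i != j by rewrite -val_eqE neq_ltn lt_ij.
case: (odd i != odd j); last by rewrite !andbF muln0.
by rewrite !andbT signed_pair_count // muln2.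
Qed.

End SignedStatistics.

(** * The quotient and the sum over signs *)

Lemma below_opp0 (n : nat) (p : 'S_n.+1) : below_opp p ord0 = 0%N.
Proof. by apply: big1 => i _. Qed.

Lemma below_opp1 (n : nat) (p : 'S_n.+2) :
  below_opp p (lift ord0 ord0) = (p ord0 < p (lift ord0 ord0))%N :> nat.
Proof. by rewrite /below_opp big_ord_recl big1 ?addn0. Qed.

(** The two ascents read -sigma(2) < sigma(1) < sigma(2): the second entry is positive and larger in
    absolute value than the first. *)
Lemma signed_perm_DnJ (n : nat) (pe : 'S_n.+2 * {ffun 'I_n.+2 -> bool}) :
  (signed_perm pe \in DnJ n.+2 [:: 0; 1]%N)
    = [&& ~~ odd #|[set i | pe.2 i]|, ~~ pe.2 (lift ord0 ord0)
        & below_opp pe.1 (lift ord0 ord0) == 1%N].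
Proof.
rewrite inE [_ \in Dn _]inE signed_perm_Bn /=; congr (~~ odd _ && _).
  apply: eq_card => i; rewrite !inE sigma_at_signed_perm.
  by case: (pe.2 i); lia.
rewrite /sigma_atD /= below_opp1.
rewrite (sigma_at_signed_perm pe ord0) (sigma_at_signed_perm pe (lift ord0 ord0)).
by case: (pe.2 ord0); case: (pe.2 _) => /=; lia.
Qed.

Lemma signed_perm_weight (n : nat) (p : 'S_n.+2) (e : {ffun 'I_n.+2 -> bool}) :
  (if ~~ e (lift ord0 ord0) && (below_opp p (lift ord0 ord0) == 1%N)
   then (-1) ^+ ell (signed_perm (p, e)) *: 'X^(oddlen (signed_perm (p, e)))
   else 0)
  = (-1) ^+ p * \prod_(i < n.+2) sign_weight i (e i) (below_opp p i).
Proof.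
case: ifP => [/andP[/negbTE e1 /eqP c1]|not_min]; last first.
  (* Outside the quotient the factor at position 1 vanishes. *)
  rewrite (bigD1 (lift ord0 ord0)) //= /sign_weight /=.
  by rewrite -[_ || _]negbK negb_or negbK not_min mul0r mulr0.
rewrite -signr_odd odd_ell oddlenE (big_morph _ (exprD 'X) (expr0 'X)) /=.
rewrite scaler_sign -mulr_sign; congr (_ * _); apply: eq_bigr => i _.
rewrite /sign_weight; case: eqP => // i1; rewrite (_ : i = lift ord0 ord0).
  by rewrite e1 c1.
exact: val_inj.
Qed.

(* The sign of the first entry is free: it affects neither the statistics nor
   the constraint, only the parity that distinguishes [D_n] from [B_n]. *)
Lemma sum_even_signs (R : comNzRingType) (n : nat) (F : 'I_n.+1 -> bool -> R) :
  F ord0 true = F ord0 false ->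
  (\sum_(e : {ffun 'I_n.+1 -> bool} | ~~ odd #|[set i | e i]|)
     \prod_i F i (e i)) *+ 2 = \prod_i \sum_(b : bool) F i b.
Proof.
move=> F0; rewrite bigA_distr_bigA /=.
pose flip (e : {ffun 'I_n.+1 -> bool}) := [ffun i => e i (+) (i == ord0)].
have flipK : involutive flip.
  by move=> e; apply/ffunP => i; rewrite !ffunE addbK.
rewrite [RHS](bigID (fun e : {ffun _ -> bool} => ~~ odd #|[set i | e i]|)) /=.
rewrite mulr2n; congr (_ + _); rewrite (reindex_inj (inv_inj flipK)) /=.
apply: eq_big => e => [|_].
  congr negb; rewrite (cardsD1 ord0) [in RHS](cardsD1 ord0) !inE ffunE eqxx addbT.
  rewrite !oddD !oddb addNb; congr (~~ (_ (+) odd _)).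
  by apply: eq_card => i; rewrite !inE ffunE; case: eqP => //= _; rewrite addbF.
apply: eq_bigr => i _; rewrite ffunE; case: eqP => [->|_]; last by rewrite addbF.
by case: (e ord0); rewrite /= F0.
Qed.

Theorem theorem5p4 (n : nat) (hn : (3 <= n)%N) :
  \sum_(s in DnJ n [:: 0%N; 1%N]) (-1) ^+ ell s *: 'X^(oddlen s)
  = (1 + 'X^2) * \prod_(4 <= j < n.+1) (1 + (-1) ^+ (j - 1) *: 'X^(j %/ 2)) ^+ 2
    :> {poly int}.
Proof.
rewrite -/(quotient_poly n).
(* Dropping the evenness condition on the signs doubles the sum, so both sides are compared after
   multiplication by 2. *)
have two_neq0 : (2%:R : {poly int}) != 0 by rewrite -polyC_natr polyC_eq0.
apply: (mulIf two_neq0); rewrite !mulr_natr -rank_weight_perm_sum //.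
case: n hn => [|[|n]] // _; rewrite big_signed_perm; last first.
  by apply/subsetP => s; rewrite inE => /andP[]; rewrite inE => /andP[].
rewrite -sumrMnl; apply: eq_bigr => p _; rewrite /perm_weight /rank_weight.
rewrite -sum_even_signs; last by rewrite /sign_weight below_opp0.
rewrite mulrnAr; congr (_ *+ 2).
rewrite (eq_bigl _ _ (fun e => signed_perm_DnJ (p, e))) big_distrr big_mkcondr /=.
by apply: eq_bigr => e _; exact: signed_perm_weight.
Qed.
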